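(* Let $X$ be an infinite compact metrizable monothetic group and $Tx=ax$ a minimal rotation of $X$ (i.e. $a\in X$ and $\{a^n:n\in\mathbb Z\}$ is dense in $X$). Let $G$ be a locally compact second countable abelian group. Then every continuous recurrent cocycle $f:X\to G$ over $(X,T)$ is regular.
   Context: A continuous map $f:X\to G$ defines a $\mathbb Z$-cocycle by $f(n,x)=f(T^{n-1}x)\cdots f(Tx)f(x)$ for $n\ge 1$, $f(0,x)=e$, and $f(n,x)=f(-n,T^nx)^{-1}$ for $n<0$. The skew product is the $\mathbb Z$-action on $X\times G$ given by $T_f^n(x,g)=(T^nx,f(n,x)g)$. The cocycle $f$ is recurrent if for every nonempty open $O\subset X\times G$ there is an integer $n\ne0$ with $T_f^nO\cap O\neq\varnothing$. It is regular if there exists $(x_0,g_0)\in X\times G$ such that the projection to $X$ of the orbit closure $\overline{T_f^{\mathbb Z}(x_0,g_0)}$ is all of $X$. *)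

(* Defs.v *)
From HB Require Import structures.
From mathcomp Require Import all_boot all_order all_algebra.
From mathcomp Require Import all_classical all_reals all_analysis.
Set Implicit Arguments.
Unset Strict Implicit.
Unset Printing Implicit Defensive.
Import Order.TTheory GRing.Theory Num.Theory.
Local Open Scope classical_set_scope.
Local Open Scope ring_scope.

(* The multiplicative, not necessarily commutative, counterpart of
   topologicalZmodType; a monothetic group is not assumed to be abelian. *)
HB.structure Definition PreTopologicalGroup := {X of Topological X & Group X}.

HB.mixin Record PreTopologicalGroup_isTopologicalGroup X
    & PreTopologicalGroup X := {
  mulg_continuous : continuous (fun x : X * X => (x.1 * x.2)%g) ;
  invg_continuous : continuous (fun x : X => x^-1%g) ;
}.

#[short(type="topologicalGroupType")]
HB.structure Definition TopologicalGroup :=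
  {X of PreTopologicalGroup X & PreTopologicalGroup_isTopologicalGroup X}.

Definition metrizable (R : realType) (X : topologicalType) : Prop :=
  exists d : X -> X -> R,
    [/\ forall x y, d x y = 0 <-> x = y,
        forall x y, d x y = d y x,
        forall x y z, d x z <= d x y + d y z &
        forall x, nbhs x = nbhs_ball_ (fun y e => [set z | d y z < e]) x].

Definition expgz (X : groupType) (a : X) (n : int) : X :=
  match n with
  | Posz k => (a ^+ k)%g
  | Negz k => (a ^- k.+1)%g
  end.

(* A homeomorphism T enters the definitions below through the Z-action
   n |-> T^n it generates; for T x = a x one has T^n x = a^n x, as
   rotation0 and rotationS confirm. *)
Definition rotation (X : groupType) (a : X) (n : int) (x : X) : X :=
  (expgz a n * x)%g.

Lemma rotation0 (X : groupType) (a x : X) : rotation a 0 x = x.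
Proof. exact: mul1g. Qed.

Lemma rotationS (X : groupType) (a : X) (n : int) (x : X) :
  rotation a (n + 1) x = (a * rotation a n x)%g.
Proof.
rewrite /rotation mulgA; congr (_ * _)%g.
case: n => [k|[|k]].
- by rewrite -PoszD addn1 /= expgS.
- by rewrite /= expg1 mulgV.
- have -> : Negz k.+1 + 1 = Negz k by rewrite !NegzE -addn1 PoszD opprD addrNK.
  by rewrite /= [in RHS]expgSr invgM mulVKg.
Qed.

Section Cocycle.
Variables (X : topologicalType) (G : topologicalZmodType).
Variables (T : int -> X -> X) (f : X -> G).

(* G is abelian and written additively. *)
Definition cocycle (n : int) (x : X) : G :=
  match n with
  | Posz k => \sum_(i < k) f (T i x)
  | Negz k => - \sum_(i < k.+1) f (T i (T (Negz k) x))
  end.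

Definition skew_product (n : int) (p : X * G) : X * G :=
  (T n p.1, cocycle n p.1 + p.2).

Definition recurrent : Prop :=
  forall O : set (X * G), open O -> O !=set0 ->
    exists2 n : int, n != 0 & (skew_product n @` O) `&` O !=set0.

Definition regular : Prop :=
  exists p0 : X * G,
    fst @` closure (range (fun n : int => skew_product n p0)) = [set: X].

End Cocycle.

(* Main.v *)
(* Call [h] an essential value if [(1, h)] lies in the closure of the set of all
   [(a^n, f(n, x))]; minimality makes the essential values a subgroup [E] of [G]
   to which every open subset of [X] contributes.  Let [D] be a compact
   neighbourhood of [0] and [V] a much smaller symmetric one.  If [a^n] is close
   to [1], then [f(n, .)] avoids [D + E] outside of [V + E], and as its
   increments along orbits are small, it takes values in [V + E] everywhere or
   nowhere.  By recurrence the times [n] of the first kind include arbitrarily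
   large ones with [a^n] close to [1]; the argument showing that a non-discrete
   locally compact monothetic group is compact then makes them syndetic, so
   that [f(n, x)] lies in [Q + E] for a fixed compact [Q].  By Baire's theorem
   some orbit closure contains [{x} * E]; it is invariant under [E], hence meets
   [{b} * Q] for every [b] in [X]. *)

Require Import Defs.
From mathcomp Require Import all_boot all_order all_algebra.
From mathcomp Require Import all_classical all_reals all_analysis.
From mathcomp Require Import zify.
Set Implicit Arguments.
Unset Strict Implicit.
Unset Printing Implicit Defensive.
Import Order.TTheory GRing.Theory Num.Theory.
Local Open Scope classical_set_scope.
Local Open Scope ring_scope.

(** * Integer powers and cocycle identities *)

(** The two-way step covers both signs at once; in a group its converse half is usually mere
    cancellation. *)
Lemma int_shift_ind (P : int -> Prop) :
  P 0 -> (forall n, P n <-> P (n + 1)) -> forall n, P n.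
Proof.
move=> P0 PS; elim/int_ind => // n IH.
- by move/PS: IH; rewrite -PoszD addn1.
- by apply/(PS _); have -> : - n.+1%:Z + 1 = - n%:Z by lia.
Qed.

Section Powers.
Variables (X : groupType) (a : X).
Implicit Types m n : int.

Lemma expgzS n : expgz a (n + 1) = (a * expgz a n)%g.
Proof. by have := rotationS a n 1%g; rewrite /rotation !mulg1. Qed.

Lemma expgzD m n : expgz a (m + n) = (expgz a m * expgz a n)%g.
Proof.
elim/int_shift_ind: m => [|m]; first by rewrite add0r [expgz a 0]expg0 mul1g.
rewrite addrAC !expgzS -mulgA.
by split=> [->|/mulgI].
Qed.

Lemma expgzN n : expgz a (- n) = (expgz a n)^-1%g.
Proof. by apply/esym/mulg1_eq; rewrite -expgzD subrr. Qed.

Lemma rotationD m n x : rotation a (m + n) x = rotation a m (rotation a n x).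
Proof. by rewrite /rotation expgzD mulgA. Qed.

Lemma rotationK n : cancel (rotation a n) (rotation a (- n)).
Proof. by move=> x; rewrite -rotationD addNr rotation0. Qed.

Lemma rotationVK n : cancel (rotation a (- n)) (rotation a n).
Proof. by move=> x; rewrite -rotationD subrr rotation0. Qed.

End Powers.

Section CocycleIdentity.
Variables (X : topologicalGroupType) (G : topologicalZmodType).
Variables (a : X) (f : X -> G).
Implicit Types m n : int.

Lemma cocycle0 x : cocycle (rotation a) f 0 x = 0.
Proof. exact: big_ord0. Qed.

Lemma cocycleS n x :
  cocycle (rotation a) f (n + 1) x =
  f (rotation a n x) + cocycle (rotation a) f n x.
Proof.
case: n => [k|k].
  by rewrite -PoszD addn1 /= big_ord_recr addrC.
have E : Negz k + 1 = - k%:Z by lia.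
(* For [k = 0] the time is [0], which falls under the other branch of [cocycle]; both sums are then
   empty. *)
have -> : cocycle (rotation a) f (Negz k + 1) x =
    - \sum_(i < k) f (rotation a i (rotation a (Negz k + 1) x)).
  by rewrite E; case: k {E} => [|k] //; rewrite /= !big_ord0 oppr0.
rewrite /= big_ord_recl rotation0 opprD addrA subrr add0r.
congr (- _); apply: eq_bigr => i _; congr f.
by rewrite -!rotationD lift0; congr rotation; lia.
Qed.

Lemma cocycleD m n x :
  cocycle (rotation a) f (m + n) x =
  cocycle (rotation a) f m (rotation a n x) + cocycle (rotation a) f n x.
Proof.
elim/int_shift_ind: m => [|m]; first by rewrite add0r cocycle0 add0r.
rewrite addrAC !cocycleS rotationD -addrA.
by split=> [->|/addrI].
Qed.

Lemma cocycleN n x :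
  cocycle (rotation a) f (- n) (rotation a n x) =
  - cocycle (rotation a) f n x.
Proof. by apply/eqP; rewrite -addr_eq0 -cocycleD addNr cocycle0. Qed.

Lemma skew_productD m n p :
  skew_product (rotation a) f (m + n) p =
  skew_product (rotation a) f m (skew_product (rotation a) f n p).
Proof. by rewrite /skew_product /= rotationD cocycleD addrA. Qed.

End CocycleIdentity.

(** * Continuity, closures and neighbourhoods *)

Lemma continuous_pair (T U V : topologicalType) (u : T -> U) (v : T -> V) :
  continuous u -> continuous v -> continuous (fun x => (u x, v x)).
Proof. by move=> uc vc x; apply: cvg_pair; [exact: uc|exact: vc]. Qed.

Lemma continuous_compose (T U V : topologicalType) (v : U -> V) (u : T -> U) :
  continuous v -> continuous u -> continuous (fun x => v (u x)).
Proof.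
by move=> vc uc x; apply: (@continuous_comp _ _ _ u v); [exact: uc|exact: vc].
Qed.

Lemma continuous_fst (T U : topologicalType) : continuous (@fst T U).
Proof. by move=> [x y]; exact: cvg_fst. Qed.

Lemma continuous_snd (T U : topologicalType) : continuous (@snd T U).
Proof. by move=> [x y]; exact: cvg_snd. Qed.

Lemma continuous_add (T : topologicalType) (G : topologicalZmodType)
    (u v : T -> G) :
  continuous u -> continuous v -> continuous (fun x => u x + v x).
Proof.
move=> uc vc; exact: (continuous_compose (@add_continuous G) (continuous_pair uc
  vc)).
Qed.

Lemma continuous_opp (T : topologicalType) (G : topologicalZmodType) (u : T ->
  G) :
  continuous u -> continuous (fun x => - u x).
Proof. exact/continuous_compose/opp_continuous. Qed.

Lemma continuous_mulg (T : topologicalType) (X : topologicalGroupType)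
    (u v : T -> X) :
  continuous u -> continuous v -> continuous (fun x => u x * v x)%g.
Proof.
move=> uc vc; exact: (continuous_compose (@mulg_continuous X) (continuous_pair
  uc vc)).
Qed.

Lemma continuous_invg (T : topologicalType) (X : topologicalGroupType) (u : T ->
  X) :
  continuous u -> continuous (fun x => (u x)^-1%g).
Proof. exact/continuous_compose/invg_continuous. Qed.

Lemma continuous_closure (T U : topologicalType) (h : T -> U)
    (A : set T) (B : set U) (p : T) :
  continuous h -> (forall q, A q -> closure B (h q)) ->
  closure A p -> closure B (h p).
Proof.
move=> hc AB Ap W Wp; have [q [Aq]] := Ap _ (hc p _ (nbhs_interior Wp)).
by move=> /= Wq; exact: (AB q Aq W).
Qed.

Lemma closure_near (T : topologicalType) (A : set T) (p : T) (P : set T) :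
  closure A p -> (\forall q \near p, P q) -> exists2 q, A q & P q.
Proof. by move=> Ap /Ap[q []]; exists q. Qed.

Lemma not_closure_near (T : topologicalType) (A : set T) (p : T) :
  ~ closure A p -> \forall q \near p, ~ closure A q.
Proof.
move=> nAp; have : open (~` closure A) by exact/closed_openC/closed_closure.
by rewrite openE => /(_ p nAp).
Qed.

Lemma near_add (G : topologicalZmodType) (g : G) (P : set G) : nbhs g P ->
  exists U V, [/\ nbhs g U, nbhs 0 V & forall u v, U u -> V v -> P (u + v)].
Proof.
rewrite -{1}[g]addr0 => gP; have [[U V] /= [Ug V0] UV] :=
  @add_continuous G (g, 0) _ gP.
by exists U, V; split => // u v Uu Vv; exact: (UV (u, v)).
Qed.

Lemma near_divg (X : topologicalGroupType) (b : X) (P : set X) : nbhs (1%g : X)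
  P ->
  exists2 W, nbhs b W & forall x y, W x -> W y -> P (x * y^-1)%g.
Proof.
move=> P1; have c : continuous (fun p : X * X => p.1 * (p.2)^-1)%g.
  by apply: continuous_mulg;
    [exact: continuous_fst|exact/continuous_invg/continuous_snd].
have [|[W1 W2] /= [W1b W2b] WP] := c (b, b) P; first by rewrite /= mulgV.
exists (W1 `&` W2); first exact: filterI.
by move=> x y [W1x _] [_ W2y]; exact: (WP (x, y)).
Qed.

Lemma hausdorff_finite_closed (T : topologicalType) (A : set T) :
  hausdorff_space T -> finite_set A -> closed A.
Proof.
by move=> /hausdorff_accessible/accessible_finite_set_closed; exact.
Qed.

(** * Baire category in compact Hausdorff spaces *)

(** Regularity gives nonempty open sets, the closure of each next one lying in the previous one and
    in [D n]; a cluster point of points chosen in them lies in every closure. *)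
Lemma compact_Baire (T : topologicalType) (D : nat -> set T) :
  compact [set: T] -> hausdorff_space T -> [set: T] !=set0 ->
  (forall n, open (D n)) -> (forall n, dense (D n)) ->
  exists x, forall n, D n x.
Proof.
move=> Tc Th T0 Do Dd.
have step n (O : set T) : open O /\ O !=set0 ->
    exists O' : set T, (open O' /\ O' !=set0) /\ closure O' `<=` O `&` D n.
  move=> [Oo O0]; have [x [Ox Dx]] := Dd n O O0 Oo.
  have xN : nbhs x (O `&` D n) by exact/open_nbhs_nbhs/(conj (openI Oo (Do n))).
  have [U Ux UO] := compact_regular Th Tc (@filterT _ (nbhs x) _) xN.
  exists U^°; split; first by split; [exact: open_interior|exists x].
  by apply: subset_trans UO; apply: closure_subset; exact: interior_subset.
pose next n (O : {O : set T | open O /\ O !=set0}) :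
    {O : set T | open O /\ O !=set0} :=
  exist _ _ (projT2 (cid (step n _ (svalP O)))).1.
pose fix O n := if n is k.+1 then next k (O k) else
  exist _ [set: T] (conj openT T0) : {O : set T | open O /\ O !=set0}.
have sub n : closure (sval (O n.+1)) `<=` sval (O n) `&` D n.
  exact: (projT2 (cid (step n _ (svalP (O n))))).2.
have mono n k : sval (O (n + k)%N) `<=` sval (O n).
  elim: k => [|k IH]; first by rewrite addn0.
  rewrite addnS; apply: subset_trans IH.
  by move=> y Oy; have [] := sub _ _ (subset_closure Oy).
pose x n := projT1 (cid (svalP (O n)).2).
have xO n : sval (O n) (x n) := projT2 (cid (svalP (O n)).2).
have [p [_ px]] := Tc (x @ \oo) _ filterT.
exists p => n; suff /sub[] : closure (sval (O n.+1)) p by [].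
move=> W Wp; apply: px => //.
exists n.+1 => // k /= nk.
by have := @mono n.+1 (k - n.+1)%N (x k); rewrite subnKC//; exact.
Qed.

Lemma compact_Baire_countable (T : topologicalType) (C : set (set T)) :
  compact [set: T] -> hausdorff_space T -> [set: T] !=set0 -> countable C ->
  (forall A, C A -> open A /\ dense A) -> exists x, forall A, C A -> A x.
Proof.
move=> Tc Th T0 /countable_injP[c cinj] Cod.
(* [D n] is the member of [C] numbered [n], or the whole space when there is none. *)
pose D n := [set x | forall A, C A -> c A = n -> A x].
have DE n : (exists2 A, C A & D n = A) \/ D n = [set: T].
  have [[A [CA cA]]|nex] := pselect (exists A, C A /\ c A = n).
    left; exists A => //; apply/seteqP; split=> [x Dx|x Ax A' CA' cA'];
      first exact: Dx.
    by rewrite (cinj A' A) ?inE// cA' cA.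
  by right; apply/seteqP; split=> // x _ A CA cA; case: nex; exists A.
have [n|n|x Dx] := @compact_Baire T D Tc Th T0.
- by have [[A /Cod[Ao _] ->] //|->] := DE n; exact: openT.
- have [[A /Cod[_ Ad] ->] //|->] := DE n.
  by move=> O O0 _; rewrite setIT.
- by exists x => A CA; exact: (Dx (c A)).
Qed.

(** * Metrizable spaces *)

Lemma metrizable_hausdorff (R : realType) (X : topologicalType) :
  metrizable R X -> hausdorff_space X.
Proof.
move=> [d [d0 dC dD dN]] p q pq; apply/d0/eqP; apply: contraT => dpq.
(* Nonnegativity comes from the triangle inequality along [p], [q], [p]. *)
have dge0 : 0 <= d p q.
  have := dD p q p; rewrite (d0 p p).2 // (dC q p) -mulr2n.
  by rewrite pmulrn_lge0.
have r0 : 0 < d p q / 2 by rewrite divr_gt0 // lt_neqAle eq_sym dpq.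
have ballN x : nbhs x [set z | d x z < d p q / 2] by rewrite dN;
  exists (d p q / 2).
have [z [/= pz qz]] := pq _ _ (ballN p) (ballN q).
have := le_lt_trans (dD p z q) (ltrD pz _).
by rewrite (dC z q) => /(_ _ qz); rewrite -splitr ltxx.
Qed.

Lemma metrizable_nbhs_basis (R : realType) (X : topologicalType) (x : X) :
  metrizable R X -> exists U : nat -> set X, (forall k, nbhs x (U k)) /\
    forall P, nbhs x P -> exists k, U k `<=` P.
Proof.
move=> [d [_ _ _ dN]]; exists (fun k => [set z | d x z < k.+1%:R^-1]);
  split=> [k|P].
  by rewrite dN; exists k.+1%:R^-1 => //=; rewrite invr_gt0.
rewrite dN => -[e /= e0 eP].
have [k ke] : exists k : nat, k.+1%:R^-1 < e.
  by exists (Num.truncn e^-1);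
    rewrite -[ltRHS]invrK ltf_pV2 ?posrE ?invr_gt0// truncnS_gt.
exists k => z /= xz; apply: eP; exact: lt_trans ke.
Qed.

(** * Minimality and the group of essential values *)

Section Regularity.
Variables (X : topologicalGroupType) (G : topologicalZmodType).
Variables (a : X) (f : X -> G).
Hypothesis X_compact : compact [set: X].
Hypothesis a_dense : dense (range (expgz a)).
Hypothesis f_continuous : continuous f.
Implicit Types (m n : int) (x y b : X) (g h : G).

Local Notation T := (rotation a).
Local Notation phi := (cocycle (rotation a) f).

Lemma rotation_continuous n : continuous (T n).
Proof.
apply: (@continuous_mulg _ X (cst (expgz a n)) id); first exact: cst_continuous.
by move=> x; exact: cvg_id.
Qed.

Lemma cocycle_continuous n : continuous (phi n).
Proof.
elim/int_shift_ind: n => [|n].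
  by rewrite (_ : phi 0 = cst 0); [exact: cst_continuous|apply/funext/cocycle0].
have -> : phi (n + 1) = fun x => f (T n x) + phi n x.
  by apply/funext => x; exact: cocycleS.
have fTc : continuous (fun x => f (T n x)).
  exact/continuous_compose/rotation_continuous.
split=> [pc|pc]; first exact: continuous_add.
have -> : phi n = fun x => - f (T n x) + (f (T n x) + phi n x).
  by apply/funext => x; rewrite addKr.
by apply: continuous_add => //; exact: continuous_opp.
Qed.

(** Every orbit is dense, not only that of [1]: right translation by [x] is a homeomorphism carrying
    the powers of [a] to the orbit of [x]. *)
Lemma rotation_near x y (P : set X) : (\forall z \near y, P z) ->
  exists n, P (T n x).
Proof.
move=> Py; pose Q := (fun b => b * x)%g @^-1` P^°.
have Qo : open Q.
  apply: open_comp; last exact: open_interior.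
  move=> b _; apply: (@continuous_mulg _ X id (cst x));
    last exact: cst_continuous.
  by move=> z; exact: cvg_id.
have [|b [/= bP [n _ nb]]] := a_dense _ Qo.
  by exists (y * x^-1)%g; rewrite /Q /= mulgVK.
by exists n; rewrite /rotation nb; exact: interior_subset bP.
Qed.

Definition value_closure : set (X * G) :=
  closure [set p | exists n x, p = (expgz a n, phi n x)].

Definition essential_value g := value_closure (1%g, g).

Lemma value_closureP n x : value_closure (expgz a n, phi n x).
Proof. by apply: subset_closure; exists n, x. Qed.

Lemma essential_value0 : essential_value 0.
Proof. by have := @value_closureP 0 1%g; rewrite cocycle0 [expgz a 0]expg0. Qed.

Lemma essential_valueN g : essential_value g -> essential_value (- g).
Proof.
rewrite /essential_value -[X in value_closure (X, - g)]invg1.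
apply: (@continuous_closure _ _ (fun p : X * G => ((p.1)^-1%g, - p.2))).
  apply: continuous_pair.
    exact/continuous_invg/continuous_fst.
  exact/continuous_opp/continuous_snd.
move=> _ [n [x ->]] /=; rewrite -expgzN -cocycleN.
exact: value_closureP.
Qed.

(** Both ways of splitting [phi (m + n) x] agree. The correction term is an increment of [phi m]
    from [x] to [T n x], hence small for fixed [m] when [a^n] is near [1]. *)
Lemma cocycle_commute m n x :
  phi n (T m x) = phi n x + (phi m (T n x) - phi m x).
Proof.
by rewrite addrA; apply/eqP; rewrite eq_sym subr_eq addrC -!cocycleD addrC.
Qed.

(* Minimality moves an essential return into any open set [O] along an orbit
   segment whose length is bounded by compactness; for [a^n] near [1] this
   changes the value of the cocycle only slightly. *)
Lemma essential_value_near g x : essential_value g ->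
  closure [set q : X * X * G | exists n y, q = (expgz a n, y, phi n y)]
    (1%g, x, g).
Proof.
move=> Eg N [[N1 W] /= [[[U O] /= [U1 Ox] UON] Wg] NN].
have [W' [V [W'g V0 W'V]]] := near_add Wg.
have /compact_near_coveringP Xcov := X_compact.
pose M := [set b | [set: X] `<=`
  (fun y => exists m, O (T m y) /\ V (phi m (b * y)%g - phi m y))].
have M1 : \forall b \near (1%g : X), M b.
  apply: Xcov => y _; have [m Om] := rotation_near y (nbhs_interior Ox).
  have OTm : \forall z \near y, O (T m z) by exact: (@rotation_continuous m y).
  pose D (p : X * X) := phi m (p.2 * p.1)%g - phi m p.1.
  have Dc : continuous D.
    apply: continuous_add; last
      exact/continuous_opp/continuous_compose/continuous_fst/cocycle_continuous.
    apply: (continuous_compose (@cocycle_continuous m)).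
    by apply: continuous_mulg; [exact: continuous_snd|exact: continuous_fst].
  have [|[A B] /= [Ay B1] AB] := Dc (y, 1%g) V;
    first by rewrite /D /= mul1g subrr.
  exists ([set z | O (T m z)] `&` A, B); first by split => //; exact: filterI.
  by move=> [z b] /= [[Oz Az] Bb]; exists m; split => //; exact: (AB (z, b)).
have Pn : nbhs ((1%g, g) : X * G) ((U `&` M) `*` W').
  by exists (U `&` M, W') => //=; split => //; exact: filterI.
have [_ [n [y ->]] /= [Ub W'p]] := closure_near Eg Pn.
have [m [Om Vm]] := Ub.2 y Logic.I.
exists (expgz a n, T m y, phi n (T m y)); split; first by exists n, (T m y).
apply: NN; split; first by apply: UON; split => //; exact: Ub.1.
by rewrite /= cocycle_commute; exact: W'V.
Qed.

(** By continuity [(b, u)] may be taken to be an actual value at [n], [x]. Then [h] is approximated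
    by [phi m y] with [y] near [T n x], and the cocycle identity joins the two segments into one of
    length [m + n] starting at [T (- n) y]. *)
Lemma value_closureD b u h :
  value_closure (b, u) -> essential_value h -> value_closure (b, u + h).
Proof.
move=> bu Eh; pose F (p : X * G) := (p.1, p.2 + h).
apply: (@continuous_closure _ _ F _ _ (b, u)) bu.
  apply: continuous_pair; first exact: continuous_fst.
  by apply: continuous_add; [exact: continuous_snd|exact: cst_continuous].
move=> _ [n [x ->]]; rewrite /F /=.
pose F' (q : X * X * G) := ((q.1.1 * expgz a n)%g, q.2 + phi n (T (- n) q.1.2)).
have -> : (expgz a n, phi n x + h) = F' (1%g, T n x, h).
  by rewrite /F' /= mul1g rotationK addrC.
apply: (@continuous_closure _ _ F' _ _ (1%g, T n x, h)) (essential_value_near (x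
  := _) Eh).
  have c1 := @continuous_fst (X * X)%type G.
  apply: continuous_pair.
    apply: continuous_mulg; last exact: cst_continuous.
    exact: (continuous_compose (@continuous_fst X X) c1).
  apply: continuous_add; first exact: continuous_snd.
  apply: (continuous_compose (@cocycle_continuous n)).
  apply: (continuous_compose (@rotation_continuous (- n))).
  exact: (continuous_compose (@continuous_snd X X) c1).
move=> _ [m [y ->]] /=.
by apply: subset_closure; exists (m + n), (T (- n) y);
  rewrite /F' /= expgzD cocycleD rotationVK.
Qed.

Lemma essential_valueD g h :
  essential_value g -> essential_value h -> essential_value (g + h).
Proof. exact: value_closureD. Qed.

(** The sum [V + E], where [E] is the group of essential values. *)
Definition thicken (V : set G) := [set g | exists2 h, essential_value h & V (g -
  h)].

Lemma thicken_self (V : set G) g : V g -> thicken V g.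
Proof. by exists 0; [exact: essential_value0|rewrite subr0]. Qed.

Lemma thickenD (V W D : set G) g h :
  (forall u v, V u -> W v -> D (u + v)) ->
  thicken V g -> thicken W h -> thicken D (g + h).
Proof.
move=> VWD [g' Eg Vg] [h' Eh Wh]; exists (g' + h');
  first exact: essential_valueD.
by rewrite opprD addrACA; exact: VWD.
Qed.

Lemma thickenN (V W : set G) g :
  (forall u, V u -> W (- u)) -> thicken V g -> thicken W (- g).
Proof.
move=> VW [h Eh Vg]; exists (- h); first exact: essential_valueN.
by rewrite -opprD; exact: VW.
Qed.

(** * Return times with values near the essential values *)

Section Returns.
Variables (D V : set G).
Hypothesis D_compact : compact D.
Hypothesis V_open : open V.
Hypothesis V0 : V 0.
Hypothesis VN : forall u, V u -> V (- u).
Hypothesis VVD : forall u v, V u -> V v -> D (u + v).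

Let VD : V `<=` D.
Proof. by move=> u Vu; rewrite -[u]addr0; exact: VVD. Qed.

(* Outside of [thicken V], the compact set [D] contains no essential value. *)
Lemma near1_cocycle_gap : \forall b \near (1%g : X), forall n x,
  expgz a n = b -> thicken D (phi n x) -> thicken V (phi n x).
Proof.
have /compact_near_coveringP Dcov := D_compact.
have gap : \forall b \near (1%g : X),
    D `<=` (fun c => value_closure (b, c) -> thicken V c).
  apply: Dcov => c _.
  (* Either [c] lies in the open set [V + E], and so do its neighbours, or [(1, c)] has a
     neighbourhood missing the closed set [value_closure]. *)
  have [[h Eh Vch]|nVc] := pselect (thicken V c).
    have cV : \forall c' \near c, V (c' - h).
      have idc : continuous (@id G) by move=> z; exact: cvg_id.
      have := @continuous_add G G id (cst (- h)) idc (@cst_continuous _ _ _) c.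
      by apply; exact: open_nbhs_nbhs.
    exists ([set c' | V (c' - h)], [set: X]); first by split => //;
      exact: filterT.
    by move=> [c' b] /= [Vc' _] _; exists h.
  have /not_closure_near [[A C] /= [A1 Cc] AC] : ~ value_closure (1%g, c).
    by move=> Ec; apply: nVc; exists c => //; rewrite subrr.
  exists (C, A) => //= -[c' b] /= [Cc' Ab] bc'.
  by have := AC (b, c') (conj Ab Cc').
apply: filterS gap => b gap n x nb [h Eh Dh].
(* Subtracting [h] brings the value into [D], and [value_closure] is invariant under essential
   values. *)
have [h' Eh' Vh'] : thicken V (phi n x - h).
  apply: gap => //; apply: value_closureD; last exact: essential_valueN.
  by rewrite -nb; exact: value_closureP.
exists (h + h'); first exact: essential_valueD.
by rewrite opprD addrA.
Qed.

(* Along an orbit [phi n] moves by increments in [V], so it cannot jump over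
   the gap. *)
Lemma near1_cocycle_uniform : \forall b \near (1%g : X), forall n,
  expgz a n = b -> (exists x, thicken D (phi n x)) ->
  forall x, thicken V (phi n x).
Proof.
have /compact_near_coveringP Xcov := X_compact.
have incr : \forall b \near (1%g : X), [set: X] `<=` (fun x => V (f (b * x)%g -
  f x)).
  apply: Xcov => x _; pose F (p : X * X) := f (p.2 * p.1)%g - f p.1.
  have Fc : continuous F.
    apply: continuous_add; last
      exact/continuous_opp/continuous_compose/continuous_fst.
    apply: (continuous_compose f_continuous).
    by apply: continuous_mulg; [exact: continuous_snd|exact: continuous_fst].
  by apply: (Fc (x, 1%g)); rewrite /F /= mul1g subrr; exact: open_nbhs_nbhs.
apply: filterS2 incr near1_cocycle_gap => b incr gap n nb [x0 Dx0] x.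
have phi1 y : phi 1 y = f y by rewrite -[1]add0r cocycleS cocycle0 addr0
  rotation0.
have incrT y : V (phi n (T 1 y) - phi n y).
  by rewrite cocycle_commute addrAC subrr add0r !phi1 /rotation nb; exact: incr.
(* A step in [V] leads from [V + E] to [D + E] at worst, and the gap sends it back to [V + E]. *)
have absorb y z : thicken V (phi n y) -> V (phi n z - phi n y) ->
  thicken V (phi n z).
  move=> Vy Vzy; apply: gap => //; rewrite -[phi n z](subrK (phi n y)) addrC.
  by apply: (thickenD VVD) => //; exact: thicken_self.
have Vorbit m : thicken V (phi n (T m x0)).
  elim/int_shift_ind: m => [|m]; first by rewrite rotation0; exact: gap.
  rewrite addrC rotationD; split=> [Vm|Vm]; first exact: absorb Vm (incrT _).
  by apply: absorb Vm _; rewrite -opprB; exact/VN/incrT.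
(* The orbit of [x0] comes so close to [x] that one more such step reaches it. *)
have Vx : \forall z \near x, V (phi n x - phi n z).
  have c : continuous (fun z => phi n x - phi n z).
    by apply: continuous_add;
      [exact: cst_continuous|exact/continuous_opp/cocycle_continuous].
  by apply: c; rewrite subrr; exact: open_nbhs_nbhs.
have [m Vm] := rotation_near x0 Vx.
exact: absorb (Vorbit m) Vm.
Qed.

Hypothesis X_infinite : infinite_set [set: X].
Hypothesis X_hausdorff : hausdorff_space X.
Hypothesis f_recurrent : recurrent (rotation a) f.

(** Otherwise the powers of [a] form a finite, hence closed, dense set, and [X] is finite. *)
Lemma expgz_neq1 (j : nat) : expgz a j.+1 != 1%g.
Proof.
apply/eqP => aj; apply: X_infinite.
have ap (q : int) : expgz a (q * j.+1%:Z) = 1%g.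
  elim/int_shift_ind: q => [|q]; first by rewrite mul0r [expgz a 0]expg0.
  by rewrite mulrDl mul1r expgzD aj mulg1.
have fin : finite_set (range (expgz a)).
  apply: (@sub_finite_set _ _ ((fun i : nat => expgz a i) @` `I_j.+1)).
    move=> _ [n _ <-]; exists `|(n %% j.+1%:Z)%Z|%N.
      rewrite /= -ltz_nat gez0_abs; last exact: modz_ge0.
      by have := ltz_pmod n (isT : 0 < j.+1%:Z).
    rewrite gez0_abs; last exact: modz_ge0.
    rewrite -[LHS]mul1g -(ap (n %/ j.+1%:Z)%Z) -expgzD.
    by rewrite -divz_eq.
  exact/finite_image/finite_II.
apply: (sub_finite_set _ fin) => x _.
by have := hausdorff_finite_closed X_hausdorff fin;
  apply => P /(rotation_near 1%g)[n Pn];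
  exists (expgz a n); split; [exists n|rewrite /rotation mulg1 in Pn].
Qed.

(** Serves to force positive return times to a small neighbourhood of [1] above [N]. *)
Lemma near1_expgz_neq (N : nat) : \forall b \near (1%g : X),
  forall j : nat, (0 < j <= N)%N -> expgz a j <> b.
Proof.
pose A := (fun j : nat => expgz a j.+1) @` `I_N.
have Ao : open (~` A) 
  by apply: closed_openC; apply: hausdorff_finite_closed => //;
    exact/finite_image/finite_II.
have A1 : (~` A) 1%g by move=> [j _ aj]; have := expgz_neq1 j; rewrite aj eqxx.
have : \forall b \near (1%g : X), (~` A) b by exact: open_nbhs_nbhs.
apply: filterS => b nAb [//|j] /= jN jb.
by apply: nAb; exists j.
Qed.

(** Recurrence for a small box around [(1, 0)]: the quotient of the base points of a returning point
    is [a^n], and the difference of its fibre coordinates is [phi n x]. *)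
Lemma recurrent_return (P : set X) : nbhs (1%g : X) P ->
  exists2 n, n != 0 & P (expgz a n) /\ exists x, V (phi n x).
Proof.
move=> P1; have [W W1 WP] := near_divg 1%g P1.
have [|[S1 S2] /= [S10 S20] SV] := @sub_continuous G (0, 0) V.
  by rewrite /= subrr; exact: open_nbhs_nbhs.
have [||n n0 [_ [[[x g] [/= Wx [S1g S2g]] <-] [/= Wnx [S1n S2n]]]]] :=
    f_recurrent (O := W^° `*` (S1^° `&` S2^°)).
- rewrite openE => -[x g] [/= Wx [S1g S2g]]; exists (W^°, S1^° `&` S2^°) => //=.
  by split; [|apply: filterI]; exact: nbhs_interior.
- by exists (1%g, 0).
exists n => //; split.
  have := WP _ _ (interior_subset Wnx) (interior_subset Wx).
  by rewrite /rotation mulgK.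
exists x; have := SV (phi n x + g, g) (conj (interior_subset S1n)
  (interior_subset S2g)).
by rewrite /= addrK.
Qed.

Definition bounded_time n := forall x, thicken V (phi n x).

(** Phrased through [b] so that [near1_cocycle_uniform] says exactly that this is a neighbourhood of
    [1]. *)
Definition return_nbhs : set X :=
  [set b | forall n, expgz a n = b -> (exists x, thicken D (phi n x)) ->
    bounded_time n].

Lemma bounded_timeN n : bounded_time n -> bounded_time (- n).
Proof.
move=> Vn x; rewrite -[x](rotationVK a n) cocycleN.
exact: thickenN (Vn _).
Qed.

(** Adding two values in [V + E] only gives one in [D + E]; the condition on [a^(m + n)] shrinks
    this back to [V + E]. *)
Lemma bounded_timeD m n : return_nbhs (expgz a (m + n)) ->
  bounded_time m -> bounded_time n -> bounded_time (m + n).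
Proof.
move=> U Vm Vn; apply: U => //; exists 1%g.
by rewrite cocycleD; exact: thickenD VVD _ _.
Qed.

(** The return time supplied by recurrence may be negative, so the neighbourhood is intersected with
    its inverse and [n] can be replaced by [- n]. *)
Lemma bounded_time_large (P : set X) (N : nat) : nbhs (1%g : X) P ->
  exists k : nat, [/\ (N < k)%N, P (expgz a k) & bounded_time k].
Proof.
move=> P1.
have : nbhs (1%g : X) (P `&` return_nbhs `&`
    [set b | forall j : nat, (0 < j <= N)%N -> expgz a j <> b]).
  by apply: filterI; [apply: filterI => //;
    exact: near1_cocycle_uniform|exact: near1_expgz_neq].
set Q := (X in nbhs _ X) => Q1.
have Q1V : nbhs (1%g : X) (monoid.inv @^-1` Q).
  by apply: (@invg_continuous X 1%g); rewrite invg1.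
have [n n0 [[[[Pn Un] Nn] [[PnV UnV] NnV]] [x Vx]]] :=
  recurrent_return (filterI Q1 Q1V).
have Bn : bounded_time n by apply: Un => //; exists x; exact/thicken_self/VD.
case: n n0 Pn Un Nn PnV UnV NnV Vx Bn => [k|k] n0 Pn _ Nn PnV _ NnV _ Bn.
  exists k; split => //; rewrite ltnNge; apply/negP => kN.
  by apply: (Nn k) => //; rewrite kN andbT lt0n.
exists k.+1; rewrite -expgzN in PnV; rewrite -expgzN in NnV.
split => //; last exact: bounded_timeN Bn.
by rewrite ltnNge; apply/negP => kN; exact: (NnV k.+1).
Qed.

(* As in the proof that a non-discrete locally compact monothetic group is
   compact: finitely many translates by positive times cover the bounded times,
   and descending along them makes the bounded times syndetic. *)
Lemma bounded_time_cover : exists N : nat, forall n, bounded_time n ->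
  exists2 p : nat, (0 < p <= N)%N & bounded_time (n - p%:Z).
Proof.
have /compact_near_coveringP Xcov := X_compact.
have U1 : nbhs (1%g : X) return_nbhs by exact: near1_cocycle_uniform.
have [W W1 WU] := near_divg 1%g U1.
suff : \forall N \near \oo, [set: X] `<=` (fun b => forall n, bounded_time n ->
    expgz a n = b -> exists2 p : nat, (0 < p <= N)%N & bounded_time (n - p%:Z)).
  move=> [N _ HN]; exists N => n Bn.
  exact: (HN N (leqnn N) (expgz a n) Logic.I).
apply: Xcov => b _.
have [S Sb SW] := near_divg b W1.
have [[n0 [Bn0 Sn0]]|nex] :=
  pselect (exists n0, bounded_time n0 /\ S (expgz a n0)); last first.
  exists (S, setT); first by split => //; exact: filterT.
  by move=> [c N] /= [Sc _] n Bn nc; case: nex; exists n; rewrite nc.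
(* As [k] exceeds the absolute value of [n0], [p = n0 + k] is positive. Both [n - n0] and [k] are
   bounded times with powers in [W], so their difference [n - p] is a bounded time as well. *)
have [k [n0k Wk Bk]] := bounded_time_large `|n0|%N W1.
set p := `|(n0 + k%:Z)%R|%N.
exists (S, [set N | (p <= N)%N]); first by split => //; exact: nbhs_infty_ge.
move=> [c N] /= [Sc pN] n Bn nc; exists p; first by rewrite pN andbT /p; lia.
have -> : n - p%:Z = (n - n0) - k%:Z by rewrite /p; lia.
have Wn : W (expgz a (n - n0)) by rewrite expgzD expgzN nc; exact: SW.
have Bnn0 : bounded_time (n - n0).
  apply: bounded_timeD => //; last exact: bounded_timeN.
  rewrite -[expgz a _]mulg1 -[X in (_ * X)%g]invg1; apply: WU => //.
  exact: nbhs_singleton.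
apply: bounded_timeD => //; last exact: bounded_timeN.
by rewrite expgzD expgzN; exact: WU.
Qed.

(** From a bounded time beyond [m], descend by steps of length at most [N]; while the distance to
    [m] exceeds [N], a step cannot pass below [m]. *)
Lemma bounded_time_syndetic : exists N : nat, forall m,
  exists2 n : nat, (n <= N)%N & bounded_time (m + n%:Z).
Proof.
have [N cov] := bounded_time_cover; exists N => m.
have [k [mk _ Bk]] := bounded_time_large `|m|%N (@filterT _ (nbhs (1%g : X)) _).
have : bounded_time (m + `|(k%:Z - m)%R|%N%:Z).
  by rewrite (_ : m + _ = k) //; lia.
elim/ltn_ind: `|_|%N => n IH Bn.
have [nN|Nn] := leqP n N; first by exists n.
have [p /andP[p0 pN] Bp] := cov _ Bn.
apply: (IH (n - p)%N); first by lia.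
by rewrite (_ : m + _ = m + n%:Z - p%:Z) //; lia.
Qed.

Lemma cocycle_compact (N : nat) : exists2 K : set G, compact K &
  forall n : nat, (n <= N)%N -> forall x, K (phi n x).
Proof.
elim: N => [|N [K Kc HK]].
  exists [set 0]; first exact: compact_set1.
  by move=> n; rewrite leqn0 => /eqP -> x; exact: cocycle0.
exists (K `|` phi N.+1 @` [set: X]).
  apply: compactU => //; apply: continuous_compact => //.
  exact/continuous_subspaceT/cocycle_continuous.
move=> n; rewrite leq_eqVlt => /predU1P[-> x|nN x]; first by right; exists x.
by left; exact: HK.
Qed.

(** Going on from time [m] to a bounded time [m + n] with [n] at most [N] changes the cocycle by an
    element of the compact set [K], so [Q = D - K] suffices. *)
Lemma cocycle_bounded : exists2 Q : set G, compact Q &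
  forall m x, thicken Q (phi m x).
Proof.
have [N syn] := bounded_time_syndetic; have [K Kc HK] := cocycle_compact N.
exists ((fun p : G * G => p.1 - p.2) @` (D `*` K)).
  apply: continuous_compact; first exact/continuous_subspaceT/sub_continuous.
  exact: compact_setX.
move=> m x; have [n nN Bn] := syn m.
have [h Eh Vh] := Bn x; exists h => //.
exists (phi (m + n%:Z) x - h, phi n (T m x)); first by split;
  [exact: VD|exact: HK].
by rewrite /= [m + _]addrC cocycleD addrAC [phi n _ + _]addrC addrK.
Qed.

End Returns.

(* Some orbit closure contains a whole coset of the essential values. *)
Lemma essential_orbit : hausdorff_space X -> @second_countable G ->
  (exists U : nat -> set X, (forall k, nbhs (1%g : X) (U k)) /\
    forall P, nbhs (1%g : X) P -> exists k, U k `<=` P) ->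
  exists x, forall g, essential_value g ->
    closure (range (fun n => skew_product T f n (x, 0))) (x, g).
Proof.
move=> Xh [B Bc [Bo Bb]] [U [U1 Ub]].
pose S (p : set G * nat) := [set y | exists2 m, U p.2 (expgz a m) & p.1 (phi m
  y)].
(* Second countability of [G] and the countable basis at [1] keep the family of dense open sets
   countable. *)
pose I := [set W | B W /\ (W `&` essential_value) !=set0] `*` [set: nat].
have Ic : countable I.
  apply: countableX => //; apply: sub_countable Bc.
  by apply: subset_card_le => W [].
have [| |A [[W k] [[BW [g [Wg Eg]]] _] <-]|x Sx] :=
    @compact_Baire_countable X (S @` I) X_compact Xh.
- by exists 1%g.
- exact: (sub_countable (card_image_le S I) Ic).
- split.
    rewrite (_ : S _ = \bigcup_(m in [set m | U k (expgz a m)]) (phi m @^-1`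
      W)).
      apply: bigcup_open => m _; apply: open_comp; last exact: Bo.
      by move=> y _; exact: cocycle_continuous.
    by apply/seteqP; split=> y [m Um Wm]; exists m.
  (* Density holds because [essential_value_near] prescribes the starting point together with the
     value. *)
  move=> O [y Oy] Oo.
  have N : nbhs (1%g, y, g) ((U k `*` O) `*` W).
    exists (U k `*` O, W) => //=; split.
      by exists (U k, O) => //=; split => //; exact: open_nbhs_nbhs.
    by apply: open_nbhs_nbhs; split => //; exact: Bo.
  have [_ [m [z ->]] [[/= Um Oz] Wm]] :=
    closure_near (essential_value_near (x := y) Eg) N.
  by exists z; split => //; exists m.
exists x => g Eg N [[A W] /= [Ax Wg] AN].
have mulx : continuous (fun b : X => b * x)%g.
  apply: (@continuous_mulg _ X id (cst x)); last exact: cst_continuous.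
  by move=> z; exact: cvg_id.
have [|k kA] := Ub ((fun b => b * x)%g @^-1` A); first by apply: mulx;
  rewrite mul1g.
have [V [BV Vg] VW] := Bb g W Wg.
have [|m Um Vm] := Sx (S (V, k)); first by exists (V, k) => //; do 2 split=> //;
  exists g.
exists (skew_product T f m (x, 0)); split; first by exists m.
by apply: AN; split; rewrite /= ?addr0; [exact: kA|exact: VW].
Qed.

End Regularity.

Theorem theorem3p5 (R : realType)
    (X : topologicalGroupType) (a : X) (G : topologicalZmodType)
    (X_infinite : infinite_set [set: X])
    (X_compact : compact [set: X])
    (X_metrizable : metrizable R X)
    (a_dense : dense (range (expgz a)))
    (G_hausdorff : hausdorff_space G)
    (G_locally_compact : locally_compact [set: G])
    (G_second_countable : @second_countable G)
    (f : X -> G) (f_continuous : continuous f)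
    (f_recurrent : recurrent (rotation a) f) :
  regular (rotation a) f.
Proof.
have X_hausdorff := metrizable_hausdorff X_metrizable.
have [D D0 [D_compact _]] : exists2 D : set G, nbhs 0 D & compact D /\ closed D.
  by have [D D0 HD] := G_locally_compact 0 Logic.I; exists D => //;
    rewrite withinET in D0.
have [V [Vo V0 VN VVD]] : exists V : set G, [/\ open V, V 0,
    forall u, V u -> V (- u) & forall u v, V u -> V v -> D (u + v)].
  have [A [B [A0 B0 AB]]] := near_add D0.
  pose W := A^° `&` B^°.
  have Wo : open W by apply: openI; exact: open_interior.
  exists (W `&` -%R @^-1` W); split.
  - apply: openI => //; apply: open_comp => // x _; exact: opp_continuous.
  - by rewrite /W /= oppr0; split.
  - by move=> u [Wu WNu] /=; rewrite opprK.
  - by move=> u v [[Au _] _] [[_ Bv] _]; apply: AB; exact: interior_subset.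
have [Q Qc HQ] := cocycle_bounded X_compact a_dense f_continuous D_compact Vo V0
  VN VVD X_infinite X_hausdorff f_recurrent.
have [x Hx] := essential_orbit X_compact a_dense f_continuous X_hausdorff
  G_second_countable (metrizable_nbhs_basis 1%g X_metrizable).
exists (x, 0); apply/seteqP; split => // b _.
set O := closure _ in Hx *.
have Oinv m p : O p -> O (skew_product (rotation a) f m p).
  apply: continuous_closure.
    apply: continuous_pair.
      exact/continuous_compose/continuous_fst/rotation_continuous.
    apply: continuous_add; last exact: continuous_snd.
    exact/continuous_compose/continuous_fst/cocycle_continuous.
  move=> _ [n _ <-]; apply: subset_closure; exists (m + n) => //.
  exact: skew_productD.
apply: contrapT => nb.
have /compact_near_coveringP Qcov := Qc.
(* [O] is closed and misses every point over [b], so compactness of [Q] gives a neighbourhood of [b]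
   over which [O] misses [Q]. *)
have : \forall c \near b, Q `<=` (fun q => ~ O (c, q)).
  apply: Qcov => q _.
  have /not_closure_near [[A C] /= [Ab Cq] AC] : ~ O (b, q).
    by move=> Obq; apply: nb; exists (b, q).
  exists (C, A) => //= -[q' c] /= [Cq' Ac].
  exact: (AC (c, q') (conj Ac Cq')).
move=> /(rotation_near a_dense x)[m Qm].
(* The cocycle at time [m] and point [x] is [h + q] with [q] in [Q]. Time [m] therefore carries the
   point [(x, - h)] of [O] to [(rotation a m x, q)], which the choice of [m] excludes from [O]. *)
have [h Eh Qh] := HQ m x.
apply: (Qm _ Qh).
have := Oinv m _ (Hx (- h) (essential_valueN Eh)).
by [].
Qed.
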